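(* Let $0<\alpha<2$ and $0<\beta<2$, and let $\mu$ be a finite positive Borel measure on $[0,1)$. Then the following statements are equivalent: (1) $\mathcal{C}_{\mu}: \mathcal{D}_{\alpha}\rightarrow \mathcal{D}_{\beta}$ is bounded. (2) $\mu$ is a $[1+\frac{1}{2}(\alpha-\beta)]$-Carleson measure on $[0, 1)$. (3) There is a constant $C>0$ such that $$\mu[n] \leq \frac{C}{(n+1)^{1+\frac{1}{2}(\alpha-\beta)}}$$ for all $n \in \mathbb{N}_{0}$.
   Context: $\mathbb{N}_0=\mathbb{N}\cup\{0\}$, $\mathbb{D}$ is the open unit disk in $\mathbb{C}$ and $\mathcal{H}(\mathbb{D})$ is the class of all analytic functions on $\mathbb{D}$. For $\alpha\in\mathbb{R}$, the Dirichlet-type space is $$\mathcal{D}_{\alpha}=\Big\{f=\sum_{n=0}^{\infty}a_nz^n\in \mathcal{H}(\mathbb{D}): \|f\|_{\mathcal{D}_{\alpha}}:=\Big(\sum_{n=0}^{\infty}(n+1)^{1-\alpha} |a_{n}|^2\Big)^{1/2}<\infty\Big\}.$$ For a positive Borel measure $\mu$ on $[0,1)$ put $\mu[n]=\int_{0}^1 t^{n}\,d\mu(t)$ for $n\in \mathbb{N}_{0}$. The generalized Cesàro operator $\mathcal{C}_{\mu}$ is defined, for $f=\sum_{n=0}^{\infty}a_n z^n \in \mathcal{H}(\mathbb{D})$, by $$\mathcal{C}_{\mu}(f)(z)=\sum_{n=0}^\infty \Big(\mu[n]\sum_{k=0}^n a_k\Big)z^n,\quad z\in \mathbb{D}.$$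 That $\mathcal{C}_{\mu}: \mathcal{D}_{\alpha}\rightarrow \mathcal{D}_{\beta}$ is bounded means that $\mathcal{C}_\mu$ maps $\mathcal{D}_\alpha$ into $\mathcal{D}_\beta$ and there is a constant $C>0$ with $\|\mathcal{C}_\mu(f)\|_{\mathcal{D}_\beta}\le C\|f\|_{\mathcal{D}_\alpha}$ for all $f\in\mathcal{D}_\alpha$. For $s>0$, a positive Borel measure $\mu$ on $[0,1)$ is an $s$-Carleson measure if there is a constant $C>0$ such that $\mu([t, 1))\leq C (1-t)^s$ for all $t\in [0, 1)$. *)

(* Defs.v *)
From HB Require Import structures.
From mathcomp Require Import all_boot all_order all_algebra.
From mathcomp Require Import complex.
From mathcomp Require Import all_classical all_reals all_analysis.

Set Implicit Arguments.
Unset Strict Implicit.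
Unset Printing Implicit Defensive.

Import Order.TTheory GRing.Theory Num.Theory.
Import numFieldNormedType.Exports.

Local Open Scope classical_set_scope.
Local Open Scope ring_scope.
Local Open Scope complex_scope.

(* [R[i]^o] is the field [R[i]] viewed as a normed space over itself; hence
   [derivable f z 1] below is complex differentiability. *)
Notation Cplx R := ((R[i])^o) (only parsing).

Definition unit_disk (R : realType) : set (Cplx R) :=
  [set z | `|z| < 1].

Definition analytic_on_disk (R : realType) (f : Cplx R -> Cplx R) : Prop :=
  forall z, unit_disk z -> derivable f z 1.

Definition has_power_series (R : realType) (f : Cplx R -> Cplx R)
    (a : nat -> Cplx R) : Prop :=
  forall z, unit_disk z -> series (fun n => a n * z ^+ n) @ \oo --> f z.

(* The sequence [a] with f = sum_n a_n z^n on the disk.  It is unique, and it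
   exists whenever [f] is analytic on the disk, the only case in which
   [coef f] is meant to be used ([get] returns a dummy value otherwise). *)
Definition coef (R : realType) (f : Cplx R -> Cplx R) : nat -> Cplx R :=
  get [set a | has_power_series f a].

Definition dirichlet_norm (R : realType) (alpha : R) (f : Cplx R -> Cplx R) :
    \bar R :=
  ((\sum_(0 <= n <oo)
     (n.+1%:R `^ (1 - alpha) * ComplexField.Normc.normc (coef f n) ^+ 2)%:E)
   `^ 2^-1)%E.

(* Functions are total on the complex plane; the conditions only concern their
   values on the disk. *)
Definition dirichlet_space (R : realType) (alpha : R) :
    set (Cplx R -> Cplx R) :=
  [set f | [/\ analytic_on_disk f, has_power_series f (coef f)
             & (dirichlet_norm alpha f < +oo)%E]].

Definition moment (R : realType)
    (mu : {finite_measure set (measurableTypeR R) -> \bar R}) (n : nat) : R :=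
  \int[mu]_(t in `[0, 1[) (t ^+ n).

Definition cesaro_op (R : realType)
    (mu : {finite_measure set (measurableTypeR R) -> \bar R})
    (f : Cplx R -> Cplx R) : Cplx R -> Cplx R :=
  fun z => lim (series (fun n =>
    ((moment mu n)%:C * \sum_(k < n.+1) coef f k) * z ^+ n : Cplx R) @ \oo).

Definition bounded_between (R : realType) (alpha beta : R)
    (T : (Cplx R -> Cplx R) -> (Cplx R -> Cplx R)) : Prop :=
  (forall f, dirichlet_space alpha f -> dirichlet_space beta (T f)) /\
  exists2 C : R, 0 < C & forall f, dirichlet_space alpha f ->
    (dirichlet_norm beta (T f) <= C%:E * dirichlet_norm alpha f)%E.

Definition carleson_measure (R : realType) (s : R)
    (mu : {finite_measure set (measurableTypeR R) -> \bar R}) : Prop :=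
  exists2 C : R, 0 < C & forall t : R, 0 <= t < 1 ->
    (mu [set` `[t, 1%R[] <= (C * (1 - t) `^ s)%:E)%E.

(* Main.v *)
(* Put s = 1 + (alpha - beta) / 2, so that 0 < s < 2.

   If mu[n] = O((n + 1) ^ - s), the squared D_beta norm of C_mu f is bounded by
   sum_n (n + 1) ^ (- 1 - alpha) |a_0 + ... + a_n| ^ 2, and a weighted discrete
   Hardy inequality, obtained from Cauchy-Schwarz with the weights
   (k + 1) ^ (1 - alpha / 2), bounds this by the squared D_alpha norm of f.
   Conversely, on f = 1 + z + ... + z ^ N the coefficients of C_mu f are at
   least mu[N] (n + 1) for n <= N; comparing the norms, of orders
   mu[N] (N + 1) ^ (2 - beta / 2) and (N + 1) ^ (1 - alpha / 2), bounds mu[N].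

   The moment and Carleson conditions are compared by Bernoulli's inequality
   (t ^ n >= 1 / 2 as long as n (1 - t) <= 1 / 2) and by slicing [0, 1) at the
   points 1 - j / (n + 1), where t ^ n = O((j + 1) ^ -4).

   As beta < 2, the coefficients of C_mu f grow at most linearly, so its power
   series converges in the disk, is complex differentiable there, and
   determines its coefficients. *)

Require Import Defs.
From HB Require Import structures.
From mathcomp Require Import all_boot all_order all_algebra.
From mathcomp Require Import complex.
From mathcomp Require Import all_classical all_reals all_analysis.
From mathcomp Require Import measurable_realfun ring lra.

Set Implicit Arguments.
Unset Strict Implicit.
Unset Printing Implicit Defensive.

Import Order.TTheory GRing.Theory Num.Theory.
Import numFieldNormedType.Exports.

Local Open Scope classical_set_scope.
Local Open Scope ring_scope.

Local Notation normc := ComplexField.Normc.normc.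

(** * Sums of powers and the discrete Hardy inequality *)

(** Multiplying [ln n <= ln (n + 1) - 1 / (n + 1)] by p and exponentiating gives this through
    [1 + x <= expR x], for exponents below 1 as well as above. *)
Lemma powR_succ_ge (R : realType) (p : R) (n : nat) : 0 < p ->
  n%:R `^ p * (1 + p / n.+1%:R) <= n.+1%:R `^ p.
Proof.
move=> p0; case: n => [|n]; first by rewrite powR0 ?gt_eqF // mul0r powR_ge0.
have n0 : 0 < n.+1%:R :> R by rewrite ltr0n.
have m0 : 0 < n.+2%:R :> R by rewrite ltr0n.
have ln_succ : ln n.+1%:R <= ln n.+2%:R - n.+2%:R^-1 :> R.
  have -> : n.+1%:R = n.+2%:R * (1 + - n.+2%:R^-1) :> R.
    by rewrite mulrDr mulrN divff ?gt_eqF // mulr1 -[in RHS](natr1 n.+1) addrK.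
  have x1 : n.+2%:R^-1 < 1 :> R by rewrite invf_lt1 // ltr1n.
  by rewrite lnM ?posrE ?lerD2l ?le_ln1Dx // ?ltrN2 // subr_gt0.
have -> : n.+2%:R `^ p = expR (p * (ln n.+2%:R - n.+2%:R^-1)) * expR (p / n.+2%:R) :> R.
  by rewrite -expRD -mulrDr subrK /powR gt_eqF.
apply: ler_pM; rewrite ?powR_ge0 ?expR_ge1Dx //.
  by rewrite addr_ge0 ?divr_ge0 ?ltW.
by rewrite /powR gt_eqF // ler_expR ler_pM2l.
Qed.

Lemma powR_subr1 (R : realType) (p x : R) : 0 < x -> x `^ (p - 1) = x `^ p / x.
Proof. by move=> x0; rewrite powRB ?(gt_eqF x0) ?implybT // powRr1 // ltW. Qed.

(** A discrete form of the integral of x ^ (p - 1) over [0, n]. The extra 1 in the constant covers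
    the case p > 1, where the summand increases. *)
Lemma sum_powR_le (R : realType) (p : R) (n : nat) : 0 < p ->
  \sum_(k < n) k.+1%:R `^ (p - 1) <= (1 + p^-1) * n%:R `^ p.
Proof.
move=> p0; elim: n => [|n IH]; first by rewrite big_ord0 powR0 ?mulr0 ?gt_eqF.
rewrite big_ord_recr /=; apply: le_trans (lerD IH (lexx _)) _.
have n0 : 0 < n.+1%:R :> R by rewrite ltr0n.
have := @powR_succ_ge R p n p0.
rewrite powR_subr1 //; set a := n.+1%:R `^ p; set b := _ `^ p; set x := n.+1%:R in n0 *.
have xV : x^-1 <= 1 by rewrite invf_le1 // ler1n.
have y0 : 0 < p * x^-1 by rewrite mulr_gt0 // invr_gt0.
have yp : p * x^-1 <= p by rewrite ger_pMr.
have b0 : 0 <= b by rewrite powR_ge0.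
have a0 : 0 <= a by rewrite powR_ge0.
have q0 : 0 < p^-1 by rewrite invr_gt0.
have pq : p^-1 * p = 1 by rewrite mulVf ?gt_eqF.
have -> : a / x = p^-1 * (a * (p * x^-1)) by rewrite mulrCA !mulrA -(mulrA a) pq mulr1.
move: (p * x^-1) y0 yp => y y0 yp h.
(* This is [b * (1 + y) <= a] rearranged. Since y <= p, the factor 1 + y becomes 1 + p, and division
   by p produces the constant 1 + 1 / p. *)
have h3 : a * y <= (1 + y) * (a - b) by nra.
have ab : 0 <= a - b by nra.
have h4 : a * y <= (1 + p) * (a - b) by nra.
have : p^-1 * (a * y) <= p^-1 * ((1 + p) * (a - b)) by rewrite ler_pM2l.
rewrite [leRHS]mulrA (mulrDr p^-1) pq; lra.
Qed.

(** The terms after the first telescope, since p (k + 2) ^ (- p - 1) is at most the drop of x ^ (-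
    p) from k + 1 to k + 2; they give 1 / p. The first term gives the 1. *)
Lemma sum_powRN_le (R : realType) (p : R) (m n : nat) : 0 < p ->
  \sum_(m <= k < n) k.+1%:R `^ (- p - 1) <= (1 + p^-1) * m.+1%:R `^ (- p).
Proof.
move=> p0.
have step k : p * k.+2%:R `^ (- p - 1) <= k.+1%:R `^ (- p) - k.+2%:R `^ (- p) :> R.
  have n0 : 0 < k.+1%:R :> R by rewrite ltr0n.
  have m0 : 0 < k.+2%:R :> R by rewrite ltr0n.
  have := @powR_succ_ge R p k.+1 p0.
  rewrite powR_subr1 // !powRN.
  have : 0 < k.+1%:R `^ p :> R by rewrite powR_gt0.
  have : 0 < k.+2%:R `^ p :> R by rewrite powR_gt0.
  move: (k.+1%:R `^ p) (k.+2%:R `^ p) => a b b0 a0 h.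
  rewrite -(ler_pM2l a0) mulrBr mulfV ?gt_eqF // -(ler_pM2l b0) !mulrBr.
  have -> : b * (a * b^-1) = a by rewrite mulrCA mulfV ?mulr1 ?gt_eqF.
  have -> : b * (a * (p * (b^-1 / k.+2%:R))) = a * (p / k.+2%:R).
    rewrite mulrCA; congr (_ * _).
    by rewrite mulrCA; congr (_ * _); rewrite mulrA mulfV ?mul1r ?gt_eqF.
  by move: h; rewrite mulrDr !mulr1 lerBrDr addrC.
have tele j : \sum_(m <= k < m + j) k.+2%:R `^ (- p - 1) <=
    p^-1 * (m.+1%:R `^ (- p) - (m + j).+1%:R `^ (- p)).
  elim: j => [|j IH]; first by rewrite addn0 big_geq // subrr mulr0.
  rewrite addnS big_nat_recr ?leq_addr //=; apply: le_trans (lerD IH (lexx _)) _.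
  have := step (m + j)%N; rewrite -(ler_pM2l (_ : 0 < p^-1)) ?invr_gt0 //.
  rewrite mulrA mulVf ?gt_eqF // mul1r; nra.
have [mn|nm] := ltnP m n; last first.
  by rewrite big_geq // mulr_ge0 ?powR_ge0 ?addr_ge0 ?invr_ge0 ?ltW.
rewrite big_ltn // mulrDl mul1r; apply: lerD.
  by apply: ler_powR; rewrite ?ler1n //; lra.
case: n mn => // n mn; rewrite big_add1 /= -(subnKC (ltnSE mn)).
apply: le_trans (tele _) _; rewrite ler_pM2l ?invr_gt0 //.
by rewrite gerBl ?powR_ge0.
Qed.

Lemma weighted_cauchy_schwarz (R : realFieldType) (w x : nat -> R) (n : nat) :
  (forall k, 0 < w k) -> (forall k, 0 <= x k) ->
  (\sum_(k < n) x k) ^+ 2 <=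
    (\sum_(k < n) w k * x k ^+ 2) * (\sum_(k < n) (w k)^-1).
Proof.
move=> w0 x0; elim: n => [|n IH]; first by rewrite !big_ord0 expr0n mul0r.
rewrite !big_ord_recr /=.
have : 0 <= \sum_(k < n) x k by apply: sumr_ge0.
have : 0 <= \sum_(k < n) w k * x k ^+ 2.
  by apply: sumr_ge0 => i _; rewrite mulr_ge0 ?sqr_ge0 ?ltW.
have : 0 <= \sum_(k < n) (w k)^-1 by apply: sumr_ge0 => i _; rewrite invr_ge0 ltW.
move: (\sum_(k < n) x k) (\sum_(k < n) w k * x k ^+ 2) (\sum_(k < n) (w k)^-1) IH.
move=> S P Q IH Q0 P0 S0.
have := w0 n; have := x0 n; move: (w n) (x n) => u y y0 u0.
have v0 : 0 < u^-1 by rewrite invr_gt0.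
have uv : u * u^-1 = 1 by rewrite mulfV ?gt_eqF.
move: (u^-1) v0 uv => v v0 uv.
have Pv0 : 0 <= P * v by rewrite mulr_ge0 // ltW.
have uyQ0 : 0 <= u * y ^+ 2 * Q by rewrite !mulr_ge0 ?sqr_ge0 // ltW.
(* Arithmetic-geometric mean inequality: the square of the right side is at least 4 (P v) (u y ^ 2
   Q) = 4 y ^ 2 P Q, and S ^ 2 <= P Q by induction. *)
have cross : 2 * (S * y) <= P * v + u * y ^+ 2 * Q.
  rewrite -(@ler_pXn2r _ 2) ?nnegrE ?addr_ge0 //; last first.
    by rewrite !mulr_ge0.
  have -> : (P * v + u * y ^+ 2 * Q) ^+ 2 =
      (P * v - u * y ^+ 2 * Q) ^+ 2 + 4 * (u * v) * y ^+ 2 * (P * Q) by ring.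
  rewrite uv; have := sqr_ge0 (P * v - u * y ^+ 2 * Q).
  have : y ^+ 2 * S ^+ 2 <= y ^+ 2 * (P * Q) by rewrite ler_wpM2l ?sqr_ge0.
  rewrite !expr2; nra.
have -> : (P + u * y ^+ 2) * (Q + v) = P * Q + (P * v + u * y ^+ 2 * Q) + (u * v) * y ^+ 2.
  by ring.
rewrite uv sqrrD mul1r lerD2r -mulr_natl lerD //.
Qed.

(* Schur test with the weight k ^ (1 - a / 2). *)
Lemma weighted_hardy (R : realType) (a : R) (x : nat -> R) (N : nat) :
  0 < a < 2 -> (forall k, 0 <= x k) ->
  \sum_(n < N) n.+1%:R `^ (- 1 - a) * (\sum_(k < n.+1) x k) ^+ 2 <=
  (1 + (a / 2)^-1) ^+ 2 * \sum_(k < N) k.+1%:R `^ (1 - a) * x k ^+ 2.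
Proof.
move=> /andP[a0 a2] x0; set p := a / 2; set K := 1 + p^-1.
have p0 : 0 < p by rewrite divr_gt0.
have K0 : 0 <= K by rewrite addr_ge0 // invr_ge0 ltW.
have pos k : 0 < k.+1%:R :> R by rewrite ltr0n.
(* With weights (k + 1) ^ (1 - p), the sum of the inverse weights is at most K (n + 1) ^ p, and - 1
   - a + p = - p - 1 because a = 2 p. *)
have inner n : n.+1%:R `^ (- 1 - a) * (\sum_(k < n.+1) x k) ^+ 2 <=
    \sum_(k < n.+1) K * n.+1%:R `^ (- p - 1) * (k.+1%:R `^ (1 - p) * x k ^+ 2).
  rewrite -mulr_sumr.
  have CS := @weighted_cauchy_schwarz R (fun k => k.+1%:R `^ (1 - p)) x n.+1
    (fun k => powR_gt0 _ (pos k)) x0.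
  have V : \sum_(k < n.+1) (k.+1%:R `^ (1 - p))^-1 <= K * n.+1%:R `^ p.
    apply: le_trans (@sum_powR_le R p n.+1 p0); apply: ler_sum => k _.
    by rewrite -powRN opprB.
  have -> : n.+1%:R `^ (- p - 1) = n.+1%:R `^ (- 1 - a) * n.+1%:R `^ p.
    rewrite -powRD ?(gt_eqF (pos n)) ?implybT //; congr (_ `^ _).
    by rewrite /p; lra.
  rewrite (mulrCA K) -(mulrA _ (K * _)) ler_wpM2l ?powR_ge0 //.
  apply: le_trans CS _; rewrite [leRHS]mulrC ler_wpM2l //.
  by apply: sumr_ge0 => k _; rewrite mulr_ge0 ?powR_ge0 ?sqr_ge0.
apply: le_trans (ler_sum _ (fun (n : 'I_N) _ => inner n)) _.
(* Once the sums are exchanged, the tail over i >= k costs K (k + 1) ^ (- p), and - p + (1 - p) = 1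
   - a restores the weight of the right side. *)
have -> : \sum_(i < N) \sum_(k < i.+1)
      K * i.+1%:R `^ (- p - 1) * (k.+1%:R `^ (1 - p) * x k ^+ 2) =
    \sum_(k < N) \sum_(i < N | (k <= i)%N)
      K * i.+1%:R `^ (- p - 1) * (k.+1%:R `^ (1 - p) * x k ^+ 2).
  rewrite [RHS](exchange_big_dep xpredT) //=; apply: eq_bigr => i _.
  rewrite (big_ord_widen N
    (fun k => K * i.+1%:R `^ (- p - 1) * (k.+1%:R `^ (1 - p) * x k ^+ 2))) //.
rewrite mulr_sumr; apply: ler_sum => k _.
rewrite -mulr_suml -mulr_sumr.
have -> : \sum_(i < N | (k <= i)%N) i.+1%:R `^ (- p - 1) =
    \sum_(k <= i < N) i.+1%:R `^ (- p - 1) :> R.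
  rewrite -(big_mkord (fun i => (k <= i)%N) (fun i => i.+1%:R `^ (- p - 1))).
  by rewrite [RHS](@big_nat_widenl _ _ _ _ 0) //; apply: eq_bigl => i; rewrite ?andbT.
have -> : k.+1%:R `^ (1 - a) = k.+1%:R `^ (- p) * k.+1%:R `^ (1 - p) :> R.
  rewrite -powRD ?(gt_eqF (pos k)) ?implybT //; congr (_ `^ _).
  by rewrite /p; lra.
rewrite -(mulrA _ _ (x k ^+ 2)) (mulrA (K ^+ 2)).
rewrite ler_wpM2r ?mulr_ge0 ?powR_ge0 ?sqr_ge0 //.
by rewrite expr2 -(mulrA K K) ler_wpM2l //; exact: sum_powRN_le.
Qed.

(** * Polynomial decay of powers *)

Lemma expRN_le (R : realType) (x : R) (k : nat) : 0 <= x ->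
  expR (- x) <= (k.+1%:R / (1 + x)) ^+ k.+1.
Proof.
move=> x0; have k0 : 0 < k.+1%:R :> R by rewrite ltr0n.
(* The exponential splits into k + 1 equal factors, to each of which [expR y >= 1 + y] applies at y
   = x / (k + 1); moreover 1 + y >= (1 + x) / (k + 1). *)
have -> : - x = k.+1%:R * - (x / k.+1%:R) by field; rewrite gt_eqF // addrC natr1.
rewrite expRM_natl expRN; apply: lerXn2r.
- by rewrite nnegrE ?invr_ge0 expR_ge0.
- by rewrite nnegrE divr_ge0 // addr_ge0.
rewrite -[leRHS]invrK lef_pV2 ?posrE ?expR_gt0 ?invr_gt0 ?divr_gt0 ?ltr_pwDl //.
apply: le_trans (expR_ge1Dx _); rewrite invf_div mulrDl lerD2r mul1r.
by rewrite invf_le1 // ler1n.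
Qed.

(** Since [r <= expR (- (1 - r))], the power decays like the exponential of - n (1 - r). Keeping n
    (1 - r) in the bound makes it uniform in r, as the slicing of [0, 1) requires. *)
Lemma exprn_le_inv (R : realType) (r : R) (k n : nat) : 0 <= r <= 1 ->
  r ^+ n <= (k.+1%:R / (1 + n%:R * (1 - r))) ^+ k.+1.
Proof.
move=> /andP[r0 r1].
have nl0 : 0 <= n%:R * (1 - r) by rewrite mulr_ge0 // subr_ge0.
apply: le_trans (expRN_le k nl0).
rewrite -mulrN expRM_natl; apply: lerXn2r; rewrite ?nnegrE ?expR_ge0 //.
by have := expR_ge1Dx (- (1 - r)); rewrite opprB addrC subrK.
Qed.

Lemma exprn_le_poly (R : realType) (r : R) (k n : nat) : 0 <= r < 1 ->
  r ^+ n <= (k.+1%:R / (1 - r)) ^+ k.+1 / n.+1%:R ^+ k.+1.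
Proof.
move=> /andP[r0 r1]; have l0 : 0 < 1 - r by rewrite subr_gt0.
have nl1 : 0 < 1 + n%:R * (1 - r) by rewrite ltr_pwDl // mulr_ge0 // ltW.
apply: (le_trans (@exprn_le_inv R r k n _)); first by rewrite r0 ltW.
rewrite -expr_div_n; apply: lerXn2r.
- by rewrite nnegrE divr_ge0 // ltW.
- by rewrite nnegrE !divr_ge0 // ltW.
rewrite -mulrA -invfM ler_pM2l // lef_pV2 ?posrE // ?mulr_gt0 //.
by rewrite -natr1; nra.
Qed.

Lemma sum_inv_sqr_le (R : realFieldType) (n : nat) :
  \sum_(k < n) (k.+1%:R ^+ 2)^-1 <= 2 :> R.
Proof.
(* The sharper bound carries the induction, because 1 / (x + 1) ^ 2 <= 1 / x - 1 / (x + 1). *)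
have step m : \sum_(k < m.+1) (k.+1%:R ^+ 2)^-1 <= 2 - m.+1%:R^-1 :> R.
  elim: m => [|m IH]; first by rewrite big_ord1 expr1n invr1; lra.
  rewrite big_ord_recr /=; apply: le_trans (lerD IH (lexx _)) _.
  have : 0 < m.+1%:R :> R by rewrite ltr0n.
  rewrite -[m.+2%:R]natr1; move: (m.+1%:R) => x x0.
  have -> : (2 - x^-1 + ((x + 1) ^+ 2)^-1 <= 2 - (x + 1)^-1) =
            ((x + 1) ^- 2 <= (x * (x + 1))^-1).
    have -> : (x * (x + 1))^-1 = x^-1 - (x + 1)^-1.
      by field; rewrite !gt_eqF // addr_gt0.
    by apply/idP/idP; lra.
  rewrite lef_pV2 ?posrE ?exprn_gt0 ?mulr_gt0 ?addr_gt0 //.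
  by rewrite expr2 ler_pM2r ?addr_gt0 // lerDl.
case: n => [|n]; first by rewrite big_ord0.
by apply: le_trans (step n) _; rewrite gerBl invr_ge0.
Qed.

(** * Complex power series with coefficients of at most linear growth *)

(** The norm of [R[i]] takes its values in [R[i]], where a positive element has zero imaginary part;
    real tolerances therefore suffice. *)
Lemma cvgC_dist_le (R : realType) (T : Type) (F : set_system T) (FF : Filter F)
    (u : T -> R[i]^o) (l : R[i]^o) :
  u x @[x --> F] --> l <->
  forall e : R, 0 < e -> \near F, normc (l - u F) <= e.
Proof.
rewrite cvgrPdist_le; split=> [h e e0|h [e e']].
  have e0' : (0 : R[i]) < (e%:C)%C by rewrite ltcR.
  by near=> x; rewrite -lecR; near: x; exact: h _ e0'.
rewrite ltcE /= => /andP[/eqP e'0 e0]; rewrite e'0.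
by near=> x; have : normc (l - u x) <= e; [near: x; exact: h|rewrite -lecR].
Unshelve. all: by end_near. Qed.

Lemma normc_ge0 (R : rcfType) (x : R[i]) : 0 <= normc x.
Proof. by case: x => a b; exact: sqrtr_ge0. Qed.

Lemma ler_normcD (R : rcfType) (x y : R[i]) : normc (x + y) <= normc x + normc y.
Proof. exact: le_normcD. Qed.

Lemma normcX (R : rcfType) (x : R[i]) n : normc (x ^+ n) = normc x ^+ n.
Proof.
by elim: n => [|n IH]; rewrite ?expr0 ?ComplexField.Normc.normc1 // !exprS
  ComplexField.Normc.normcM IH.
Qed.

Lemma normcR (R : rcfType) (x : R) : normc (x%:C)%C = `|x|.
Proof. by rewrite /normc /= expr0n addr0 sqrtr_sqr. Qed.

Lemma normc_nat (R : rcfType) n : normc (n%:R : R[i]) = n%:R.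
Proof. by rewrite -(rmorph_nat (real_complex R)) normcR normr_nat. Qed.

Lemma ler_normc_sum (R : rcfType) (I : Type) (r : seq I) (P : pred I) (F : I -> R[i]) :
  normc (\sum_(i <- r | P i) F i) <= \sum_(i <- r | P i) normc (F i).
Proof.
elim/big_rec2 : _ => [|i y x _ h]; first by rewrite ComplexField.Normc.normc0.
by apply: le_trans (ler_normcD _ _) _; rewrite lerD2l.
Qed.

Lemma normc_lim_le (R : realType) (u : nat -> R[i]^o) (l : R[i]^o) (B : R) :
  u @ \oo --> l -> (\forall n \near \oo, normc (u n) <= B) -> normc l <= B.
Proof.
move=> /cvgC_dist_le h uB; apply/ler_addgt0Pl => e e0.
have [n [h1 h2]] := filter_ex (filterI (h _ e0) uB).
rewrite -(subrK (u n) l); apply: le_trans (ler_normcD _ _) _; exact: lerD.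
Qed.

Lemma normc_ge_Re_Im (R : rcfType) (z : R[i]) :
  `|complex.Re z| <= normc z /\ `|complex.Im z| <= normc z.
Proof.
case: z => a b /=.
by split; rewrite -sqrtr_sqr ler_wsqrtr // (lerDl, lerDr) sqr_ge0.
Qed.

Lemma normc_le_Re_Im (R : rcfType) (z : R[i]) :
  normc z <= `|complex.Re z| + `|complex.Im z|.
Proof.
case: z => a b /=.
rewrite -[leRHS]ger0_norm ?addr_ge0 // -[leRHS]sqrtr_sqr ler_wsqrtr //.
rewrite sqrrD !real_normK ?num_real // addrAC lerDl mulrn_wge0 // mulr_ge0 //.
Qed.

Lemma is_cvg_series_inv_sqr_dominated (R : realType) (K : R) (u : nat -> R) :
  (forall n, `|u n| <= K / n.+1%:R ^+ 2) -> cvgn (series u).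
Proof.
move=> h; apply: normed_cvg.
apply: nondecreasing_is_cvgn.
  by apply: (@nondecreasing_series _ (fun n => `|u n|)) => n _ _; exact: normr_ge0.
have K0 : 0 <= K by have := le_trans (normr_ge0 _) (h 0%N); rewrite expr1n divr1.
exists (K * 2) => _ [n _ <-]; rewrite /= /series /= big_mkord.
apply: (@le_trans _ _ (\sum_(k < n) K / k.+1%:R ^+ 2)); first exact: ler_sum.
by rewrite -mulr_sumr ler_wpM2l // sum_inv_sqr_le.
Qed.

Lemma cvg_seriesC_dominated (R : realType) (K : R) (u : nat -> R[i]^o) :
  (forall n, normc (u n) <= K / n.+1%:R ^+ 2) ->
  exists l : R[i]^o, series u @ \oo --> l.
Proof.
move=> h.
have cR : cvgn (series (fun n => complex.Re (u n))).
  by apply: is_cvg_series_inv_sqr_dominated => n; apply: le_trans (h n);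
    have [] := normc_ge_Re_Im (u n).
have cI : cvgn (series (fun n => complex.Im (u n))).
  by apply: is_cvg_series_inv_sqr_dominated => n; apply: le_trans (h n);
    have [] := normc_ge_Re_Im (u n).
exists (limn (series (fun n => complex.Re (u n))) +i*
        limn (series (fun n => complex.Im (u n))))%C.
apply/cvgC_dist_le => e e0; have e2 : 0 < e / 2 by rewrite divr_gt0.
have Re_series n : complex.Re (series u n) = series (fun n => complex.Re (u n)) n.
  by rewrite /series /=; elim/big_rec2 : _ => //= i y1 y2 _ <-; case: (u i) y2 => ? ? [].
have Im_series n : complex.Im (series u n) = series (fun n => complex.Im (u n)) n.
  by rewrite /series /=; elim/big_rec2 : _ => //= i y1 y2 _ <-; case: (u i) y2 => ? ? [].
near=> n; apply: le_trans (normc_le_Re_Im _) _.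
have -> : e = e / 2 + e / 2 by rewrite -splitr.
have ReB (x y : R[i]) : complex.Re (x - y) = complex.Re x - complex.Re y.
  by case: x y => ? ? [].
have ImB (x y : R[i]) : complex.Im (x - y) = complex.Im x - complex.Im y.
  by case: x y => ? ? [].
rewrite ReB ImB Re_series Im_series /=.
apply: lerD; near: n.
  by move/cvgrPdist_le : cR; apply.
by move/cvgrPdist_le : cI; apply.
Unshelve. all: by end_near. Qed.

(** Growth shared by the coefficient sequences of D_beta for beta < 2; it makes the power series and
    its termwise derivative converge on the disk. *)
Definition linear_growth (R : realType) (b : nat -> R[i]^o) :=
  exists2 M : R, 0 <= M & forall n, normc (b n) <= M * n.+1%:R.

(** The factor (n + 1) ^ 2 leaves room for termwise derivatives and second-order remainders.
    Together with linear growth it is cubic, and r ^ n = O((n + 1) ^ -5) turns the product into a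
    summable inverse square. *)
Lemma power_term_le (R : realType) (b : nat -> R[i]^o) (r : R) :
  linear_growth b -> 0 <= r < 1 -> exists2 K : R, 0 <= K &
    forall n, n.+1%:R ^+ 2 * normc (b n) * r ^+ n <= K / n.+1%:R ^+ 2.
Proof.
move=> [M M0 bM] /[dup] r01 /andP[r0 r1].
have l0 : 0 < 1 - r by rewrite subr_gt0.
exists (M * (5%:R / (1 - r)) ^+ 5).
  by rewrite mulr_ge0 // exprn_ge0 // divr_ge0 // ltW.
move=> n; have n0 : 0 < n.+1%:R :> R by rewrite ltr0n.
apply: (@le_trans _ _ (M * n.+1%:R ^+ 3 * r ^+ n)).
  rewrite ler_wpM2r ?exprn_ge0 // [leRHS](_ : _ = n.+1%:R ^+ 2 * (M * n.+1%:R)).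
    by rewrite ler_wpM2l ?exprn_ge0.
  by ring.
apply: (@le_trans _ _ (M * n.+1%:R ^+ 3 * ((5%:R / (1 - r)) ^+ 5 / n.+1%:R ^+ 5))).
  by rewrite ler_wpM2l ?mulr_ge0 ?exprn_ge0 // exprn_le_poly.
rewrite le_eqVlt; apply/orP; left; apply/eqP; field.
by rewrite !gt_eqF // addrC natr1.
Qed.

Lemma power_series_cvg (R : realType) (b : nat -> R[i]^o) (z : R[i]^o) :
  linear_growth b -> normc z < 1 ->
  exists l : R[i]^o, series (fun n => b n * z ^+ n) @ \oo --> l.
Proof.
move=> gb z1; have r01 : 0 <= normc z < 1 by rewrite normc_ge0.
have [K K0 h] := power_term_le gb r01.
apply: (@cvg_seriesC_dominated R K) => n; apply: le_trans (h n).
rewrite ComplexField.Normc.normcM normcX ler_wpM2r ?exprn_ge0 ?normc_ge0 //.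
by rewrite ler_peMl ?normc_ge0 // exprn_ege1 // ler1n.
Qed.

Lemma power_series_deriv_cvg (R : realType) (b : nat -> R[i]^o) (z : R[i]^o) :
  linear_growth b -> normc z < 1 ->
  exists l : R[i]^o, series (fun n => b n * (n%:R * z ^+ n.-1)) @ \oo --> l.
Proof.
move=> gb z1.
(* A radius strictly above |z| is positive even at z = 0, so |z| ^ (n - 1) <= r ^ n / r for n >=
   1. *)
set r := (1 + normc z) / 2.
have zr : normc z <= r by rewrite /r; lra.
have r0 : 0 < r by have := normc_ge0 z; rewrite /r; lra.
have r01 : 0 <= r < 1 by rewrite ltW //=; rewrite /r; lra.
move: r zr r0 r01 => {}r zr r0 r01.
have [K K0 h] := power_term_le gb r01.
apply: (@cvg_seriesC_dominated R (K / r)) => n; rewrite mulrAC.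
rewrite ler_pdivlMr //; apply: le_trans (h n).
rewrite !ComplexField.Normc.normcM normcX normc_nat.
case: n => [|n]; first by rewrite mul0r mulr0 mul0r expr0 mulr1 mulr_ge0 ?normc_ge0.
rewrite [leLHS](_ : _ = n.+1%:R * normc (b n.+1) * (normc z ^+ n * r)); last by ring.
apply: ler_pM; rewrite ?mulr_ge0 ?exprn_ge0 ?normc_ge0 ?(ltW r0) //.
- rewrite ler_wpM2r ?normc_ge0 // expr2.
  apply: (@le_trans _ _ n.+2%:R); first by rewrite ler_nat.
  by rewrite ler_peMl // ler1n.
- by rewrite /= exprSr ler_wpM2r ?(ltW r0) // lerXn2r ?nnegrE ?normc_ge0 ?(ltW r0).
Qed.

(** The remainder P_n satisfies P_(n+1) = w P_n + n z ^ (n - 1) (w - z) ^ 2, so its constant passes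
    from n ^ 2 to n ^ 2 + n <= (n + 1) ^ 2. The factor r ^ 2 on the left avoids the exponent n -
    2. *)
Lemma power_taylor2_le (R : realType) (z w : R[i]) (r : R) (n : nat) :
  normc z <= r -> normc w <= r ->
  normc (w ^+ n - z ^+ n - n%:R * z ^+ n.-1 * (w - z)) * r ^+ 2 <=
  n%:R ^+ 2 * r ^+ n * normc (w - z) ^+ 2.
Proof.
move=> zr wr; have r0 : 0 <= r := le_trans (normc_ge0 _) zr.
elim: n => [|n IH].
  by rewrite !expr0 subrr mul0r mul0r subrr ComplexField.Normc.normc0 mul0r
    expr0n /= !mul0r.
have -> : w ^+ n.+1 - z ^+ n.+1 - n.+1%:R * z ^+ n.+1.-1 * (w - z) =
    w * (w ^+ n - z ^+ n - n%:R * z ^+ n.-1 * (w - z)) +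
    n%:R * z ^+ n.-1 * (w - z) ^+ 2.
  case: n {IH} => [|n] /=; first by rewrite !expr0 !expr1; ring.
  by rewrite -[n.+2%:R]natr1 !exprS; ring.
set P := w ^+ n - _ - _ in IH *; set h := w - z in IH *.
apply: (@le_trans _ _ ((normc w * normc P +
  n%:R * normc z ^+ n.-1 * normc h ^+ 2) * r ^+ 2)).
  rewrite ler_wpM2r ?exprn_ge0 //; apply: le_trans (ler_normcD _ _) _.
  by rewrite !ComplexField.Normc.normcM !normcX normc_nat.
have h1 : normc w * normc P * r ^+ 2 <= r * (n%:R ^+ 2 * r ^+ n * normc h ^+ 2).
  by rewrite -mulrA ler_pM // ?normc_ge0 // mulr_ge0 ?normc_ge0 ?exprn_ge0.
have h2 : n%:R * normc z ^+ n.-1 * normc h ^+ 2 * r ^+ 2 <= n%:R * r ^+ n.+1 * normc h ^+ 2.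
  rewrite mulrAC ler_wpM2r ?exprn_ge0 ?normc_ge0 //.
  case: n {IH P h1} => [|n] /=; first by rewrite !mul0r.
  rewrite -mulrA ler_wpM2l // -[n.+2]addn2 exprD ler_wpM2r ?exprn_ge0 //.
  by rewrite lerXn2r ?nnegrE ?normc_ge0.
rewrite mulrDl; apply: le_trans (lerD h1 h2) _.
have q0 : 0 <= r ^+ n.+1 * normc h ^+ 2 by rewrite mulr_ge0 ?exprn_ge0 ?normc_ge0.
rewrite [leLHS](_ : _ = (n%:R ^+ 2 + n%:R) * (r ^+ n.+1 * normc h ^+ 2)); last first.
  by rewrite !(exprS r); ring.
rewrite -[leRHS]mulrA ler_wpM2r // -natr1.
by have : 0 <= n%:R :> R by []; rewrite !expr2; nra.
Qed.

Lemma unit_diskP (R : realType) (z : R[i]^o) : unit_disk z <-> normc z < 1.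
Proof. by rewrite /unit_disk /= -ltcR. Qed.

Lemma power_series_derivable (R : realType) (f : R[i]^o -> R[i]^o) (b : nat -> R[i]^o) :
  linear_growth b -> has_power_series f b -> analytic_on_disk f.
Proof.
move=> gb fb z /unit_diskP z1.
have [D hD] := power_series_deriv_cvg gb z1.
set r := (1 + normc z) / 2.
have zr : normc z < r by rewrite /r; lra.
have r0 : 0 < r by have := normc_ge0 z; rewrite /r; lra.
have r1 : r < 1 by rewrite /r; lra.
move: r zr r0 r1 => {}r zr r0 r1.
have r01 : 0 <= r < 1 by rewrite ltW.
have [K K0 hK] := power_term_le gb r01.
(* Second-order Taylor bound with D as derivative: the termwise remainders are summed over partial
   sums, then passed to the limit. *)
have main w : normc w <= r ->
    normc (f w - f z - D * (w - z)) <= (K * 2 / r ^+ 2) * normc (w - z) ^+ 2.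
  move=> wr.
  apply: (@normc_lim_le R (fun N => series (fun n => b n * w ^+ n) N -
     series (fun n => b n * z ^+ n) N -
     series (fun n => b n * (n%:R * z ^+ n.-1)) N * (w - z))).
    apply: cvgB; first apply: cvgB.
    - by apply: fb; apply/unit_diskP; exact: le_lt_trans r1.
    - by apply: fb; apply/unit_diskP.
    - exact: cvgMl.
  near=> N.
  rewrite /series /= mulr_suml -!sumrB big_mkord.
  apply: le_trans (ler_normc_sum _ _ _) _.
  rewrite mulrAC ler_pdivlMr ?exprn_gt0 // mulr_suml.
  apply: (@le_trans _ _ (\sum_(k < N) (K / k.+1%:R ^+ 2) * normc (w - z) ^+ 2)).
    apply: ler_sum => k _.
    rewrite [X in normc X](_ : _ =
      b k * (w ^+ k - z ^+ k - k%:R * z ^+ k.-1 * (w - z))); last by ring.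
    rewrite ComplexField.Normc.normcM -(mulrA (normc (b k))).
    apply: (@le_trans _ _ (normc (b k) * (k%:R ^+ 2 * r ^+ k * normc (w - z) ^+ 2))).
      by rewrite ler_wpM2l ?normc_ge0 // power_taylor2_le // ltW.
    rewrite (mulrA (normc (b k))) ler_wpM2r ?exprn_ge0 ?normc_ge0 //.
    apply: le_trans (hK k); rewrite mulrA (mulrC (normc (b k))).
    rewrite ler_wpM2r ?exprn_ge0 ?(ltW r0) // ler_wpM2r ?normc_ge0 //.
    by rewrite lerXn2r ?nnegrE // ler_nat.
  rewrite -mulr_suml ler_wpM2r ?exprn_ge0 ?normc_ge0 //.
  by rewrite -mulr_sumr ler_wpM2l // sum_inv_sqr_le.
apply/cvg_ex; exists D; apply/cvgC_dist_le => e e0.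
set C := K * 2 / r ^+ 2 in main.
have C0 : 0 <= C by rewrite divr_ge0 ?exprn_ge0 ?mulr_ge0 ?(ltW r0).
(* The first bound keeps z + h within radius r; the second makes C |h| at most e, with C + 1 as
   denominator in case C = 0. *)
have d0 : (0 : R[i]) < ((Num.min (r - normc z) (e / (C + 1)))%:C)%C.
  by rewrite ltcR lt_min subr_gt0 zr divr_gt0 // ltr_pwDr.
near=> h.
have h0 : h != 0 by near: h; exact: nbhs_dnbhs_neq.
have hs : normc h < Num.min (r - normc z) (e / (C + 1)).
  rewrite -ltcR; near: h; apply: dnbhs0_lt => //.
move: hs; rewrite lt_min => /andP[h1 h2].
have nh0 : 0 < normc h.
  rewrite lt_neqAle normc_ge0 andbT eq_sym; apply: contra_neq h0.
  exact: ComplexField.Normc.eq0_normc.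
have := main (h + z) _; rewrite addrK => /(_ _) main'.
have {main'} : normc (f (h + z) - f z - D * h) <= C * normc h ^+ 2.
  apply: main'; apply: le_trans (ler_normcD _ _) _; rewrite -lerBrDr ltW //.
rewrite /= [h *: 1]mulr1 /= => hm.
rewrite -(ler_pM2l nh0) -ComplexField.Normc.normcM.
rewrite -normcN.
rewrite [X in normc X](_ : _ = f (h + z) - f z - D * h); last first.
  have -> : h^-1 *: (f (h + z) - f z) = h^-1 * (f (h + z) - f z) by [].
  by rewrite mulrBr opprB (mulrA h) mulfV // mul1r (mulrC h).
apply: le_trans hm _; rewrite expr2 mulrCA ler_wpM2l ?normc_ge0 //.
move: h2; rewrite ltr_pdivlMr ?ltr_pwDr // => h2; apply: le_trans (ltW h2).
by rewrite mulrC ler_wpM2l ?normc_ge0 // lerDl.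
Unshelve. all: by end_near. Qed.

(** * Uniqueness of power series coefficients *)

Lemma sum_geometric_le (R : realFieldType) (q : R) (m n : nat) : 0 <= q <= 2^-1 ->
  \sum_(m <= k < n) q ^+ k <= 2 * q ^+ m.
Proof.
move=> /andP[q0 q2].
have [mn|nm] := leqP m n; last by rewrite big_geq ?mulr_ge0 ?exprn_ge0 // ltnW.
rewrite -(subnKC mn); move: (n - m)%N => j.
(* The added remainder makes the induction close, as q ^ k + 2 q ^ (k + 1) <= 2 q ^ k when q <= 1 /
   2. *)
suff : \sum_(m <= k < m + j) q ^+ k + 2 * q ^+ (m + j) <= 2 * q ^+ m.
  by apply: le_trans; rewrite lerDl mulr_ge0 ?exprn_ge0.
elim: j => [|j IH]; first by rewrite addn0 big_geq // add0r.
apply: le_trans IH; rewrite addnS big_nat_recr ?leq_addr //= -addrA lerD2l exprS.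
have : 0 <= q ^+ (m + j) by rewrite exprn_ge0.
by nra.
Qed.

(** Strong induction on the index: once the earlier coefficients vanish, evaluation at a small r > 0
    gives |d_m| r ^ m = O(r ^ (m + 1)), and r tends to 0. *)
Lemma power_series_eq0 (R : realType) (d : nat -> R[i]^o) :
  (forall z : R[i]^o, unit_disk z -> series (fun n => d n * z ^+ n) @ \oo --> (0 : R[i]^o)) ->
  forall n, d n = 0.
Proof.
move=> d0.
have half1 : `|2^-1| < 1 :> R by rewrite ger0_norm // invf_lt1 // ltr1n.
(* Convergence at 1 / 2 makes the terms d_n / 2 ^ n bounded. *)
have [M M0 dM] : exists2 M : R, 0 <= M & forall n, normc (d n) <= M * 2 ^+ n.
  have : @unit_disk R ((2^-1)%:C)%C by apply/unit_diskP; rewrite normcR.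
  move=> /d0 h; have := cvg_series_cvg_0 (cvgP _ h).
  move=> /(cvgP _) /cvg_seq_bounded /pinfty_ex_gt0[M M0 hM].
  have ME : M = ((complex.Re M)%:C)%C.
    by move: M0; rewrite ltcE /= => /andP[/eqP M0 _]; case: (M) M0 => a b /= ->.
  exists (complex.Re M); first by rewrite -lecR -ME ltW.
  move=> n; have : normc (d n * ((2^-1)%:C)%C ^+ n) <= complex.Re M.
    by rewrite -lecR -ME; exact: hM.
  rewrite ComplexField.Normc.normcM normcX normcR ger0_norm // exprVn.
  by rewrite ler_pdivrMr ?exprn_gt0.
elim/ltn_ind => m IH; apply: ComplexField.Normc.eq0_normc.
apply/eqP; rewrite eq_le normc_ge0 andbT.
(* The tail beyond m is at most 2 M (2 r) ^ (m + 1) = K r ^ (m + 1), provided 2 r <= 1 / 2; hence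
   the restriction r <= 1 / 4 below. *)
pose K := M * 2 * 2 ^+ m.+1.
have K0 : 0 <= K by rewrite !mulr_ge0 ?exprn_ge0.
have small r : 0 < r <= 4^-1 -> normc (d m) <= K * r.
  move=> /andP[r0 r4].
  have r1 : r < 1 by apply: le_lt_trans r4 _; rewrite invf_lt1 // ltr1n.
  have rm0 : 0 < r ^+ m by rewrite exprn_gt0.
  rewrite -(ler_pM2r rm0).
  have -> : normc (d m) * r ^+ m = normc (d m * ((r)%:C)%C ^+ m).
    by rewrite ComplexField.Normc.normcM normcX normcR ger0_norm // ltW.
  have cv : series (fun n => d n * ((r)%:C)%C ^+ n) x - d m * ((r)%:C)%C ^+ m @[x --> \oo]
      --> (0 - d m * ((r)%:C)%C ^+ m : R[i]^o).
    apply: cvgB; last exact: cvg_cst.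
    by apply: d0; apply/unit_diskP; rewrite normcR ger0_norm // ltW.
  rewrite -normcN -sub0r; apply: (normc_lim_le cv).
  near=> N; have mN : (m < N)%N by near: N; exact: nbhs_infty_gt.
  rewrite /series /= (big_cat_nat (n := m)) //=; last exact: ltnW.
  rewrite big_nat big1 ?add0r; last by move=> k /andP[_ /IH ->]; rewrite mul0r.
  rewrite big_ltn //.
  rewrite [X in normc X](_ : _ = \sum_(m.+1 <= k < N) d k * (r%:C)%C ^+ k); last first.
    by rewrite addrAC subrr add0r.
  apply: le_trans (ler_normc_sum _ _ _) _.
  apply: (@le_trans _ _ (\sum_(m.+1 <= k < N) M * (2 * r) ^+ k)).
    apply: ler_sum => k _; rewrite ComplexField.Normc.normcM normcX normcR.
    by rewrite ger0_norm ?(ltW r0) // exprMn mulrA ler_wpM2r ?exprn_ge0 // ltW.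
  rewrite -mulr_sumr.
  have : \sum_(m.+1 <= k < N) (2 * r) ^+ k <= 2 * (2 * r) ^+ m.+1.
    by apply: sum_geometric_le; rewrite mulr_ge0 ?(ltW r0) //=; lra.
  move=> /(ler_wpM2l M0) h; apply: le_trans h _.
  rewrite exprMn [r ^+ m.+1]exprS /K le_eqVlt; apply/orP; left; apply/eqP; ring.
apply/ler_addgt0Pl => e e0; rewrite addr0.
have r0 : 0 < Num.min 4^-1 (e / (K + 1)) by rewrite lt_min invr_gt0 divr_gt0 // ltr_pwDr.
apply: le_trans (small (Num.min 4^-1 (e / (K + 1))) _) _; first by rewrite r0 ge_min lexx.
apply: (@le_trans _ _ (K * (e / (K + 1)))).
  by rewrite ler_wpM2l // ge_min lexx orbT.
rewrite mulrA ler_pdivrMr ?ltr_pwDr // mulrC.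
by rewrite ler_pM2l // lerDl.
Unshelve. all: by end_near. Qed.

Lemma power_series_inj (R : realType) (f : R[i]^o -> R[i]^o) (a b : nat -> R[i]^o) :
  has_power_series f a -> has_power_series f b -> a = b.
Proof.
move=> fa fb; apply/funext => n; apply/eqP; rewrite -subr_eq0; apply/eqP.
apply: (@power_series_eq0 R (fun n => a n - b n)) => z z1.
rewrite -[X in _ --> X](subrr (f z)).
rewrite (_ : series _ = fun n => series (fun n => a n * z ^+ n) n -
    series (fun n => b n * z ^+ n) n).
  by apply: cvgB; [exact: fa|exact: fb].
by apply/funext => N; rewrite /series /= -sumrB; apply: eq_bigr => k _; rewrite mulrBl.
Qed.

(** [get] returns some expansion of f as soon as one exists; uniqueness identifies it with a. *)
Lemma coefE (R : realType) (f : R[i]^o -> R[i]^o) (a : nat -> R[i]^o) :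
  has_power_series f a -> coef f = a.
Proof.
move=> fa; apply: power_series_inj (fa).
exact: (getPex (ex_intro [set b | has_power_series f b] a fa)).
Qed.

Lemma has_power_series_lim (R : realType) (b : nat -> R[i]^o) : linear_growth b ->
  has_power_series (fun z => lim (series (fun n => b n * z ^+ n : R[i]^o) @ \oo)) b.
Proof.
move=> gb z /unit_diskP z1; have [l hl] := power_series_cvg gb z1.
exact: (cvgP _ hl).
Qed.

Lemma power_series_finite_support (R : realType) (a : nat -> R[i]^o) (N : nat) (z : R[i]^o) :
  (forall n, (N <= n)%N -> a n = 0) ->
  series (fun n => a n * z ^+ n) @ \oo --> (\sum_(n < N) a n * z ^+ n : R[i]^o).
Proof.
move=> a0; apply: cvg_near_cst; near=> n.
have Nn : (N <= n)%N by near: n; exact: nbhs_infty_ge.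
rewrite /series /= (big_cat_nat (n := N)) //= big_mkord.
rewrite [X in _ + X]big_nat [X in _ + X]big1 ?addr0 //.
by move=> k /andP[/a0 -> _]; rewrite mul0r.
Unshelve. all: by end_near. Qed.

(** * Weighted coefficient sums *)

Lemma powR_sqr (R : realType) (x p : R) : (x `^ p) ^+ 2 = x `^ (p * 2).
Proof. by rewrite powRrM powR_mulrn // powR_ge0. Qed.

(** Here m, x and y stand for the moments and the moduli of the coefficients of f and of its image.
    Squaring the decay of m turns the weight exponent 1 - beta into - 1 - alpha, the one in the
    Hardy inequality. *)
Lemma cesaro_partial_sum_le (R : realType) (alpha beta C : R) (m x y : nat -> R) (N : nat) :
  0 < alpha < 2 -> 0 <= C -> (forall n, 0 <= m n) -> (forall n, 0 <= x n) ->
  (forall n, m n <= C / n.+1%:R `^ (1 + (alpha - beta) / 2)) ->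
  (forall n, 0 <= y n <= m n * \sum_(k < n.+1) x k) ->
  \sum_(n < N) n.+1%:R `^ (1 - beta) * y n ^+ 2 <=
  (C * (1 + (alpha / 2)^-1)) ^+ 2 * \sum_(n < N) n.+1%:R `^ (1 - alpha) * x n ^+ 2.
Proof.
move=> a02 C0 m0 x0 mC yx; rewrite exprMn -mulrA.
apply: le_trans (ler_wpM2l (sqr_ge0 C) (weighted_hardy N a02 x0)).
rewrite mulr_sumr; apply: ler_sum => n _.
have n0 : 0 < n.+1%:R :> R by rewrite ltr0n.
have S0 : 0 <= \sum_(k < n.+1) x k by apply: sumr_ge0.
have /andP[y0 yn] := yx n.
have : y n ^+ 2 <= (C / n.+1%:R `^ (1 + (alpha - beta) / 2) * \sum_(k < n.+1) x k) ^+ 2.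
  rewrite lerXn2r ?nnegrE ?mulr_ge0 ?invr_ge0 ?powR_ge0 //.
  by apply: le_trans yn _; rewrite ler_wpM2r.
move=> /(ler_wpM2l (powR_ge0 n.+1%:R (1 - beta))) h; apply: le_trans h _.
rewrite -powRN !exprMn powR_sqr.
have -> : n.+1%:R `^ (-1 - alpha) =
    n.+1%:R `^ (1 - beta) * n.+1%:R `^ (- (1 + (alpha - beta) / 2) * 2).
  by rewrite -powRD ?(gt_eqF n0) ?implybT //; congr (_ `^ _); field.
by rewrite le_eqVlt; apply/orP; left; apply/eqP; ring.
Qed.

Lemma sum_cube_ge (R : realFieldType) (n : nat) :
  n%:R ^+ 4 <= 4 * \sum_(k < n) k.+1%:R ^+ 3 :> R.
Proof.
elim: n => [|n IH]; first by rewrite big_ord0 expr0n mulr0.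
rewrite big_ord_recr /= mulrDr; apply: le_trans (lerD IH (lexx _)).
rewrite -natr1; have : 0 <= n%:R :> R by [].
move: (n%:R) => x x0; rewrite -subr_ge0.
rewrite [X in 0 <= X](_ : _ = 6 * x ^+ 2 + 8 * x + 3); last by ring.
by rewrite !addr_ge0 ?mulr_ge0 ?sqr_ge0.
Qed.

(** As m decreases and beta > 0, the left sum is at least m_N ^ 2 (N + 1) ^ (4 - beta) / 4, while
    the right side is O((N + 1) ^ (2 - alpha)). Taking square roots isolates m_N. *)
Lemma cesaro_test_bound (R : realType) (alpha beta C : R) (m : nat -> R) (N : nat) :
  alpha < 2 -> 0 < beta -> 0 <= C -> (forall n, 0 <= m n) ->
  (forall n k, (n <= k)%N -> m k <= m n) ->
  \sum_(n < N.+1) n.+1%:R `^ (1 - beta) * (m n * n.+1%:R) ^+ 2 <=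
    C ^+ 2 * \sum_(n < N.+1) n.+1%:R `^ (1 - alpha) ->
  m N <= (2 * C * (1 + (2 - alpha)^-1)) / N.+1%:R `^ (1 + (alpha - beta) / 2).
Proof.
move=> a2 b0 C0 m0 mN h.
have p0 : 0 < 2 - alpha by rewrite subr_gt0.
set K := 1 + (2 - alpha)^-1.
have K1 : 1 <= K by rewrite lerDl invr_ge0 ltW.
have n0 n : 0 < n.+1%:R :> R by rewrite ltr0n.
have upper : \sum_(n < N.+1) n.+1%:R `^ (1 - alpha) <= K * N.+1%:R `^ (2 - alpha).
  apply: le_trans (sum_powR_le N.+1 p0); rewrite le_eqVlt; apply/orP; left; apply/eqP.
  by apply: eq_bigr => k _; congr (_ `^ _); lra.
have lower : m N ^+ 2 * N.+1%:R `^ (- beta) * \sum_(n < N.+1) n.+1%:R ^+ 3 <=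
    \sum_(n < N.+1) n.+1%:R `^ (1 - beta) * (m n * n.+1%:R) ^+ 2.
  rewrite mulr_sumr; apply: ler_sum => n _.
  have -> : n.+1%:R `^ (1 - beta) * (m n * n.+1%:R) ^+ 2 =
      m n ^+ 2 * n.+1%:R `^ (- beta) * n.+1%:R ^+ 3.
    rewrite powRD ?(gt_eqF (n0 n)) ?implybT // powRr1 //; ring.
  rewrite ler_wpM2r ?exprn_ge0 // ler_pM ?sqr_ge0 ?powR_ge0 //.
    by rewrite lerXn2r ?nnegrE // mN // -ltnS.
  rewrite !powRN lef_pV2 ?posrE ?powR_gt0 //.
  by rewrite ge0_ler_powR ?nnegrE ?(ltW b0) // ler_nat.
(* The constant obtained is 4 C ^ 2 K; since K >= 1 it is enlarged to the perfect square (2 C K) ^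
   2. *)
have key : m N ^+ 2 * N.+1%:R `^ (4 - beta) <= (2 * C * K) ^+ 2 * N.+1%:R `^ (2 - alpha).
  have -> : N.+1%:R `^ (4 - beta) = N.+1%:R `^ (- beta) * N.+1%:R ^+ 4.
    rewrite -powR_mulrn // -powRD ?(gt_eqF (n0 N)) ?implybT //; congr (_ `^ _).
    by rewrite addrC.
  have s4 := sum_cube_ge R N.+1.
  apply: (@le_trans _ _ (4 * (m N ^+ 2 * N.+1%:R `^ (- beta) * \sum_(n < N.+1) n.+1%:R ^+ 3))).
    rewrite (mulrCA 4) (mulrA (m N ^+ 2)) ler_wpM2l ?mulr_ge0 ?sqr_ge0 ?powR_ge0 //.
  have h2 := le_trans (le_trans lower h) (ler_wpM2l (sqr_ge0 C) upper).
  apply: le_trans (ler_wpM2l (ler0n R 4) h2) _.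
  rewrite [leRHS](_ : _ = 4 * (C ^+ 2 * (K * (K * N.+1%:R `^ (2 - alpha))))); last by ring.
  rewrite ler_wpM2l // ler_wpM2l ?sqr_ge0 // ler_peMl // mulr_ge0 ?powR_ge0 //.
  exact: le_trans K1.
rewrite -(@ler_pXn2r _ 2) ?nnegrE ?divr_ge0 ?mulr_ge0 ?powR_ge0 ?(le_trans ler01 K1) //.
rewrite exprMn exprVn powR_sqr -powRN.
have q0 : 0 < N.+1%:R `^ (4 - beta) by rewrite powR_gt0.
rewrite -(ler_pM2r q0); apply: le_trans key _.
rewrite -(mulrA ((2 * C * K) ^+ 2)) ler_wpM2l ?sqr_ge0 //.
rewrite -powRD ?(gt_eqF (n0 N)) ?implybT // le_eqVlt; apply/orP; left; apply/eqP.
by congr (_ `^ _); field.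
Qed.

(** The squared D_alpha norm as a function of the coefficient sequence, free of the square root and
    of the choice made by [coef]. *)
Definition dirichlet_sum (R : realType) (alpha : R) (a : nat -> R[i]^o) : \bar R :=
  (\sum_(0 <= n <oo) (n.+1%:R `^ (1 - alpha) * normc (a n) ^+ 2)%:E)%E.

Lemma dirichlet_term_ge0 (R : realType) (alpha : R) (a : nat -> R[i]^o) (n : nat) :
  0 <= n.+1%:R `^ (1 - alpha) * normc (a n) ^+ 2.
Proof. by rewrite mulr_ge0 ?powR_ge0 ?sqr_ge0. Qed.

Lemma dirichlet_sum_ge0 (R : realType) (alpha : R) (a : nat -> R[i]^o) :
  (0 <= dirichlet_sum alpha a)%E.
Proof. by apply: nneseries_ge0 => n _ _; rewrite lee_fin dirichlet_term_ge0. Qed.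

Lemma dirichlet_partial_sum_le (R : realType) (alpha : R) (a : nat -> R[i]^o) (N : nat) :
  ((\sum_(n < N) n.+1%:R `^ (1 - alpha) * normc (a n) ^+ 2)%:E <= dirichlet_sum alpha a)%E.
Proof.
rewrite -sumEFin -(big_mkord xpredT
  (fun n => (n.+1%:R `^ (1 - alpha) * normc (a n) ^+ 2)%:E)).
by apply: nneseries_lim_ge => n _ _; rewrite lee_fin dirichlet_term_ge0.
Qed.

Lemma dirichlet_sum_le (R : realType) (alpha : R) (a : nat -> R[i]^o) (B : \bar R) :
  (forall N, (\sum_(n < N) n.+1%:R `^ (1 - alpha) * normc (a n) ^+ 2)%:E <= B)%E ->
  (dirichlet_sum alpha a <= B)%E.
Proof.
move=> h; apply: lime_le.
  by apply: is_cvg_ereal_nneg_natsum => n _; rewrite lee_fin dirichlet_term_ge0.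
by apply: nearW => N; rewrite big_mkord sumEFin.
Qed.

Lemma dirichlet_normE (R : realType) (alpha : R) (f : R[i]^o -> R[i]^o) :
  dirichlet_norm alpha f = (dirichlet_sum alpha (coef f) `^ 2^-1)%E.
Proof. by []. Qed.

Lemma poweR12_le_scaled (R : realType) (C : R) (x y : \bar R) :
  0 <= C -> (0 <= x)%E -> (0 <= y)%E ->
  (x `^ 2^-1 <= C%:E * y `^ 2^-1)%E <-> (x <= (C ^+ 2)%:E * y)%E.
Proof.
move=> C0 x0 y0.
have sqK (z : \bar R) : (0 <= z)%E -> ((z `^ 2^-1) `^ 2 = z)%E.
  by move=> z0; rewrite -poweRrM mulVf // poweRe1.
have C2 : (((C ^+ 2)%:E) `^ 2^-1 = C%:E)%E.
  by rewrite poweR_EFin powR12_sqrt ?sqr_ge0 // sqrtr_sqr ger0_norm.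
have Cy0 : (0 <= (C ^+ 2)%:E * y)%E by rewrite mule_ge0 // lee_fin sqr_ge0.
rewrite -{1}C2 -poweRM ?lee_fin ?sqr_ge0 //; split=> h.
  rewrite -(sqK x) // -(sqK _ Cy0); apply: gt0_ler_poweR => //;
    by rewrite in_itv /= leey poweR_ge0.
apply: gt0_ler_poweR => //.
- by rewrite in_itv /= leey x0.
- by rewrite in_itv /= leey Cy0.
Qed.

(** A single term is at most the whole sum S, and 1 - beta > - 1, so |b_n| ^ 2 <= (n + 1) S. The
    constant 1 + S replaces the square root of S, because S <= (1 + S) ^ 2. *)
Lemma linear_growth_dirichlet (R : realType) (beta : R) (b : nat -> R[i]^o) :
  beta < 2 -> (dirichlet_sum beta b < +oo)%E -> linear_growth b.
Proof.
move=> b2 fin; have S0 := dirichlet_sum_ge0 beta b.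
pose S := fine (dirichlet_sum beta b).
have SE : dirichlet_sum beta b = S%:E by rewrite fineK // ge0_fin_numE.
have {}S0 : 0 <= S by rewrite -lee_fin -SE.
exists (1 + S); first by rewrite addr_ge0.
move=> n; have n0 : 0 < n.+1%:R :> R by rewrite ltr0n.
have : n.+1%:R `^ (1 - beta) * normc (b n) ^+ 2 <= S.
  rewrite -lee_fin -SE; apply: le_trans (dirichlet_partial_sum_le beta b n.+1).
  rewrite lee_fin big_ord_recr /= lerDr; apply: sumr_ge0 => k _.
  exact: dirichlet_term_ge0.
have : n.+1%:R^-1 <= n.+1%:R `^ (1 - beta) :> R.
  rewrite -powR_inv1 //; apply: ler_powR; first by rewrite ler1n.
  lra.
move=> /(ler_wpM2r (sqr_ge0 (normc (b n)))) h1 h2.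
have := le_trans h1 h2; rewrite ler_pdivrMl // => h3.
rewrite -(@ler_pXn2r _ 2) ?nnegrE ?normc_ge0 ?mulr_ge0 ?addr_ge0 //.
apply: le_trans h3 _.
have : 1 <= n.+1%:R :> R by rewrite ler1n.
move: (n.+1%:R) => t t1; rewrite exprMn.
have : t <= t ^+ 2 by rewrite expr2; nra.
have : S <= (1 + S) ^+ 2 by rewrite expr2; nra.
move=> h4 h5; rewrite mulrC ler_pM //; lra.
Qed.

(** * Moments and tails *)

Lemma bernoulli_ineq (R : realDomainType) (t : R) (n : nat) : 0 <= t <= 1 ->
  1 - n%:R * (1 - t) <= t ^+ n.
Proof.
move=> /andP[t0 t1]; elim: n => [|n IH]; first by rewrite mul0r subr0.
rewrite exprS; apply: le_trans (ler_wpM2l t0 IH).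
have : 0 <= n%:R :> R by [].
rewrite -natr1; move: (n%:R) => x x0; rewrite -subr_ge0.
rewrite [X in 0 <= X](_ : _ = x * (1 - t) ^+ 2); last by ring.
by rewrite mulr_ge0 ?sqr_ge0.
Qed.

Lemma powRV (R : realType) (x p : R) : 0 <= x -> x^-1 `^ p = (x `^ p)^-1.
Proof. by move=> x0; rewrite -powR_inv1 // -powRrM mulN1r powRN. Qed.

Section moments.
Context {R : realType}.
Variable mu : {finite_measure set (measurableTypeR R) -> \bar R}.

Let fin_mu (A : set (measurableTypeR R)) : measurable A -> (mu A < +oo)%E.
Proof. by move=> mA; rewrite ltey_eq fin_num_measure. Qed.

Let integrable_exprn (n : nat) :
  mu.-integrable `[0%R, 1%R[%classic (EFin \o (fun t : measurableTypeR R => t ^+ n)).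
Proof.
apply: measurable_bounded_integrable => //; first exact: fin_mu.
exists 1; split=> // x x1 t /=; rewrite in_itv /= => /andP[t0 t1].
by rewrite ger0_norm ?exprn_ge0 // (le_trans _ (ltW x1)) // exprn_ile1 // ltW.
Qed.

Lemma EFin_moment (n : nat) :
  (moment mu n)%:E = (\int[mu]_(t in `[0%R, 1%R[) (t ^+ n)%:E)%E.
Proof.
rewrite /moment /Rintegral fineK //; apply: integrable_fin_num => //.
exact: integrable_exprn.
Qed.

Lemma moment_ge0 (n : nat) : 0 <= moment mu n.
Proof.
by apply: Rintegral_ge0 => t /=; rewrite in_itv /= => /andP[t0 _]; rewrite exprn_ge0.
Qed.

Lemma moment_nonincreasing (n k : nat) : (n <= k)%N -> moment mu k <= moment mu n.
Proof.
move=> nk; apply: le_Rintegral => //; [exact: integrable_exprn..|].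
move=> t /=; rewrite in_itv /= => /andP[t0 t1].
by rewrite ler_wiXn2l // ltW.
Qed.

(** Chebyshev's inequality for t ^ n at level 1 / 2: by Bernoulli's inequality, x ^ n >= 1 / 2 on
    all of [t, 1). *)
Lemma moment_ge_tail (t : R) (n : nat) : 0 <= t < 1 -> n%:R * (1 - t) <= 2^-1 ->
  (mu [set` `[t, 1%R[] <= (2 * moment mu n)%:E)%E.
Proof.
move=> /andP[t0 t1] nt.
have : ((2^-1)%:E * mu [set` `[t, 1%R[] <= (moment mu n)%:E)%E.
  rewrite EFin_moment -integral_cst //.
  apply: (@le_trans _ _ (\int[mu]_(x in `[t, 1%R[) (x ^+ n)%:E)%E); last first.
    apply: ge0_subset_integral => //.
    - by apply/measurable_EFinP; exact: exprn_measurable.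
    - by move=> x /=; rewrite in_itv /= lee_fin => /andP[x0 _]; rewrite exprn_ge0.
    - by move=> x /=; rewrite !in_itv /= => /andP[/(le_trans t0) -> ->].
  apply: ge0_le_integral => //.
  - by move=> x _; rewrite lee_fin invr_ge0.
  - by apply/measurable_EFinP; exact: exprn_measurable.
  - move=> x /=; rewrite in_itv /= => /andP[tx x1]; rewrite lee_fin.
    apply: (@le_trans _ _ (1 - n%:R * (1 - t))); first by lra.
    apply: le_trans (@bernoulli_ineq _ x n _); last by rewrite (le_trans t0 tx) ltW.
    by rewrite lerD2l lerN2 ler_wpM2l // lerD2l lerN2.
by rewrite EFinM muleC lee_pdivrMr // muleC.
Qed.

Lemma carleson_of_moment (s : R) : 0 <= s ->
  (exists2 C : R, 0 < C & forall n : nat, moment mu n <= C / n.+1%:R `^ s) ->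
  carleson_measure s mu.
Proof.
move=> s0 [C C0 hC]; exists (2 * C * 2 `^ s); first by rewrite !mulr_gt0 ?powR_gt0.
move=> t /[dup] t01 /andP[t0 t1].
have d0 : 0 < 1 - t by rewrite subr_gt0.
have x0 : 0 <= (2 * (1 - t))^-1 by rewrite invr_ge0 mulr_ge0 // ltW.
(* m is the largest integer with m (1 - t) <= 1 / 2. Then m + 1 > 1 / (2 (1 - t)), so (m + 1) ^ (-
   s) <= 2 ^ s (1 - t) ^ s. *)
have /andP[] := truncn_itv x0; set m := Num.trunc _ => m1 m2.
have d20 : 0 < 2 * (1 - t) by rewrite mulr_gt0.
apply: (le_trans (@moment_ge_tail t m t01 _)).
  move: m1; rewrite -(ler_pM2r d20) mulVf ?gt_eqF //; lra.
rewrite lee_fin -!mulrA ler_pM2l //; apply: le_trans (hC m) _.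
rewrite ler_pM2l // -powRM ?(ltW d0) // -powRV //.
rewrite ge0_ler_powR ?nnegrE ?invr_ge0 ?(ltW d20) //.
by rewrite -[leRHS]invrK lef_pV2 ?posrE ?invr_gt0 // ltW.
Qed.

(** On this range n (1 - t) is at least of order j. The fourth power beats the growth (j + 1) ^ s
    with s <= 2 of the Carleson bound and leaves a summable (j + 1) ^ -2. *)
Lemma exprn_le_quartic (t : R) (j n : nat) : 0 <= t -> (j <= n)%N ->
  t <= 1 - j%:R / n.+1%:R -> t ^+ n <= (8 / j.+1%:R) ^+ 4.
Proof.
move=> t0 jn tj.
have jn0 : 0 <= j%:R / n.+1%:R :> R by rewrite divr_ge0.
have t1 : 0 <= t <= 1 by rewrite t0 (le_trans tj) // gerBl.
apply: (le_trans (@exprn_le_inv R t 3 n t1)).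
have h : j.+1%:R / 2 <= 1 + n%:R * (1 - t).
  have : n%:R * (j%:R / n.+1%:R) <= n%:R * (1 - t) by rewrite ler_wpM2l // lerBrDr -lerBrDl.
  have : j%:R / 2 <= 2^-1 + n%:R * (j%:R / n.+1%:R) :> R.
    have q1 : j%:R / n.+1%:R <= 1 :> R.
      by rewrite ler_pdivrMr ?ltr0n // mul1r ler_nat leqW.
    have jE : j%:R = (j%:R / n.+1%:R) * (n%:R + 1) :> R.
      by rewrite natr1 mulfVK // pnatr_eq0.
    rewrite {1}jE; have : 0 <= n%:R :> R by [].
    move: (n%:R) (j%:R / n.+1%:R) jn0 q1 => x q q0 q1 x0; nra.
  move=> h1 h2; rewrite -natr1 mulrDl mul1r.
  by move: (n%:R * (1 - t)) (n%:R * (j%:R / n.+1%:R)) (j%:R / 2) h1 h2 => x y z; lra.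
have p0 : 0 < j.+1%:R / 2 :> R by rewrite divr_gt0.
apply: lerXn2r.
- by rewrite nnegrE divr_ge0 // (le_trans (ltW p0)).
- by rewrite nnegrE divr_ge0.
rewrite (_ : 8 / j.+1%:R = 4 / (j.+1%:R / 2)); last by field; rewrite addrC natr1 gt_eqF.
by rewrite ler_pM2l // lef_pV2 ?posrE // (lt_le_trans p0).
Qed.

(* Slicing at the heights 1 - j / (n + 1) majorizes t ^ n by a step function. *)
Lemma moment_of_carleson (s : R) : 0 <= s <= 2 ->
  carleson_measure s mu ->
  exists2 C : R, 0 < C & forall n : nat, moment mu n <= C / n.+1%:R `^ s.
Proof.
move=> /andP[s0 s2] [C C0 hC]; exists (8 ^+ 4 * 2 * C); first by rewrite !mulr_gt0 ?exprn_gt0.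
move=> n; have n0 : 0 < n.+1%:R :> R by rewrite ltr0n.
pose c j : R := (8 / j.+1%:R) ^+ 4.
(* Nested intervals ending at 1, rather than disjoint slices, so that the Carleson condition applies
   to each of them; the one with j = n is [0, 1). *)
pose A (j : nat) : set (measurableTypeR R) := `[1 - j.+1%:R / n.+1%:R, 1%R[%classic.
have mA j : measurable (A j) by exact: measurable_itv.
have mcA j : measurable_fun (`[0%R, 1%R[%classic : set (measurableTypeR R))
    (fun x => (c j * \1_(A j) x)%:E).
  by apply/measurable_EFinP/measurable_funM => //; exact: measurable_indic.
have c0 j : 0 <= c j by rewrite exprn_ge0 // divr_ge0.
have step t : 0 <= t < 1 -> t ^+ n <= \sum_(j < n.+1) c j * \1_(A j) t.
  move=> /andP[t0 t1].
  have x0 : 0 <= n.+1%:R * (1 - t) by rewrite mulr_ge0 // subr_ge0 ltW.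
  have /andP[m1 m2] := truncn_itv x0.
  (* The slice index satisfies j <= (n + 1) (1 - t) <= j + 1. At t = 0 the truncation equals n + 1,
     hence the cap at n. *)
  pose j := minn (Num.trunc (n.+1%:R * (1 - t))) n.
  have jn : (j < n.+1)%N by rewrite ltnS geq_minr.
  rewrite (bigD1 (Ordinal jn)) //=.
  apply: ler_wpDr.
    by apply: sumr_ge0 => k _; rewrite mulr_ge0.
  rewrite indicE mem_set ?mulr1.
    apply: exprn_le_quartic => //.
    rewrite lerBrDr -lerBrDl ler_pdivrMr // mulrC; apply: le_trans m1.
    by rewrite ler_nat geq_minl.
  rewrite /A /= in_itv /= t1 andbT lerBlDr -lerBlDl ler_pdivlMr // mulrC.
  rewrite /j /minn; case: ifP => _; first exact: ltW.
  by rewrite ler_piMr ?(ltW n0) //; lra.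
rewrite -lee_fin EFin_moment.
apply: (@le_trans _ _ (\int[mu]_(t in `[0%R, 1%R[) \sum_(j < n.+1) (c j * \1_(A j) t)%:E)%E).
  apply: ge0_le_integral => //.
  - by move=> x /=; rewrite in_itv /= lee_fin => /andP[x0 _]; rewrite exprn_ge0.
  - by apply/measurable_EFinP; exact: exprn_measurable.
  - by apply: emeasurable_sum => j; exact: mcA.
  - by move=> x /=; rewrite in_itv /= sumEFin lee_fin => /step.
rewrite ge0_integral_sum //; last first.
  by move=> j x _; rewrite lee_fin mulr_ge0.
(* The measure of A_j is at most C ((j + 1) / (n + 1)) ^ s, and (j + 1) ^ s <= (j + 1) ^ 2. Summing
   the inverse squares then gives the factor 2 of the constant. *)
have term (j : 'I_n.+1) : (\int[mu]_(x in `[0%R, 1%R[) (c j * \1_(A j) x)%:E <=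
    (8 ^+ 4 * C / n.+1%:R `^ s * (j.+1%:R ^+ 2)^-1)%:E)%E.
  under eq_integral do rewrite EFinM.
  rewrite ge0_integralZl //; last 2 first.
  - by apply/measurable_EFinP; exact: measurable_indic.
  - by rewrite lee_fin.
  rewrite integral_indic // (_ : A j `&` _ = A j); last first.
    apply/setIidPl => x; rewrite /A /= !in_itv /= => /andP[h ->]; rewrite andbT.
    by apply: le_trans h; rewrite subr_ge0 ler_pdivrMr // mul1r ler_nat.
  have jn1 : 0 <= (1 - j.+1%:R / n.+1%:R : R) < 1.
    rewrite subr_ge0 ler_pdivrMr // mul1r ler_nat ltn_ord /=.
    by rewrite gtrBl divr_gt0.
  apply: (@le_trans _ _ ((c j)%:E * (C * (j.+1%:R / n.+1%:R) `^ s)%:E)%E).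
    rewrite lee_wpmul2l ?lee_fin //; have := hC _ jn1.
    by rewrite subKr.
  rewrite -EFinM lee_fin powRM ?invr_ge0 // powRV //.
  have : j.+1%:R `^ s <= j.+1%:R ^+ 2 :> R.
    by rewrite -powR_mulrn // ler_powR // ler1n.
  have j0 : 0 < j.+1%:R :> R by rewrite ltr0n.
  move=> hj; rewrite /c expr_div_n.
  apply: (@le_trans _ _ (8 ^+ 4 / j.+1%:R ^+ 4 * (C * (j.+1%:R ^+ 2 / n.+1%:R `^ s)))).
    by rewrite ler_wpM2l ?divr_ge0 ?exprn_ge0 // ler_pM2l // ler_wpM2r.
  rewrite le_eqVlt; apply/orP; left; apply/eqP; field.
  by rewrite gt_eqF ?powR_gt0 //= addrC natr1 gt_eqF.
apply: le_trans (lee_sum _ (fun j _ => term j)) _.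
rewrite sumEFin lee_fin -mulr_sumr.
rewrite [leRHS](_ : _ = 8 ^+ 4 * C / n.+1%:R `^ s * 2); last by ring.
by rewrite ler_wpM2l ?sum_inv_sqr_le // !mulr_ge0 ?invr_ge0 ?powR_ge0 // ltW.
Qed.

End moments.

(** * The Cesaro operator *)

Section cesaro.
Context {R : realType}.
Variables (alpha beta : R) (mu : {finite_measure set (measurableTypeR R) -> \bar R}).

Definition cesaro_coef (a : nat -> R[i]^o) (n : nat) : R[i]^o :=
  ((moment mu n)%:C)%C * \sum_(k < n.+1) a k.

Lemma dirichlet_space_sum_lty (f : R[i]^o -> R[i]^o) :
  dirichlet_space alpha f -> (dirichlet_sum alpha (coef f) < +oo)%E.
Proof. by case=> _ _; apply: lty_poweRy; rewrite invr_eq0. Qed.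

Lemma dirichlet_space_power_series (gamma : R) (f : R[i]^o -> R[i]^o) (a : nat -> R[i]^o) :
  linear_growth a -> has_power_series f a -> (dirichlet_sum gamma a < +oo)%E ->
  dirichlet_space gamma f.
Proof.
move=> ga fa fin; split; first exact: power_series_derivable ga fa.
  by rewrite (coefE fa).
by rewrite dirichlet_normE (coefE fa) poweR_lty.
Qed.

Lemma cesaro_op_power_series (f : R[i]^o -> R[i]^o) :
  linear_growth (cesaro_coef (coef f)) ->
  has_power_series (cesaro_op mu f) (cesaro_coef (coef f)).
Proof. exact: has_power_series_lim. Qed.

Lemma normc_cesaro_coef_le (a : nat -> R[i]^o) (n : nat) :
  normc (cesaro_coef a n) <= moment mu n * \sum_(k < n.+1) normc (a k).
Proof.
rewrite ComplexField.Normc.normcM normcR ger0_norm ?moment_ge0 //.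
by rewrite ler_wpM2l ?moment_ge0 // ler_normc_sum.
Qed.

Lemma bounded_of_moment : 0 < alpha < 2 -> beta < 2 ->
  (exists2 C : R, 0 < C & forall n : nat,
    moment mu n <= C / n.+1%:R `^ (1 + (alpha - beta) / 2)) ->
  bounded_between alpha beta (cesaro_op mu).
Proof.
move=> a02 b2 [C C0 mC]; have /andP[a0 _] := a02.
set K := C * (1 + (alpha / 2)^-1).
have K0 : 0 < K by rewrite mulr_gt0 // ltr_pwDl // invr_ge0 divr_ge0 // ltW.
(* The estimate concerns the candidate coefficients. Finiteness of their sum gives the growth that
   makes the series converge and identifies them with [coef (cesaro_op mu f)]. *)
have sum_le f : (dirichlet_sum beta (cesaro_coef (coef f)) <=
    (K ^+ 2)%:E * dirichlet_sum alpha (coef f))%E.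
  apply: dirichlet_sum_le => N.
  apply: (@le_trans _ _ ((K ^+ 2)%:E *
      (\sum_(n < N) n.+1%:R `^ (1 - alpha) * normc (coef f n) ^+ 2)%:E)%E).
    rewrite -EFinM lee_fin; apply: (@cesaro_partial_sum_le R alpha beta C (moment mu)
      (fun n => normc (coef f n)) (fun n => normc (cesaro_coef (coef f) n))) => //.
    - exact: ltW.
    - exact: moment_ge0.
    - by move=> n; exact: normc_ge0.
    - by move=> n; rewrite normc_ge0 normc_cesaro_coef_le.
  by rewrite lee_wpmul2l ?lee_fin ?sqr_ge0 // dirichlet_partial_sum_le.
have fin f : dirichlet_space alpha f ->
    (dirichlet_sum beta (cesaro_coef (coef f)) < +oo)%E.
  move=> /dirichlet_space_sum_lty fin; apply: le_lt_trans (sum_le f) _.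
  by rewrite lte_mul_pinfty ?lee_fin ?sqr_ge0.
have series f : dirichlet_space alpha f ->
    has_power_series (cesaro_op mu f) (cesaro_coef (coef f)).
  by move=> /fin /(linear_growth_dirichlet b2) /cesaro_op_power_series.
split=> [f fD|].
  apply: dirichlet_space_power_series (series f fD) (fin f fD).
  exact: linear_growth_dirichlet b2 (fin f fD).
exists K => // f fD; rewrite !dirichlet_normE (coefE (series f fD)).
by apply/poweR12_le_scaled; rewrite ?dirichlet_sum_ge0 // ltW.
Qed.

(* Test functions: the partial sums of the geometric series. *)
Lemma moment_of_bounded : alpha < 2 -> 0 < beta ->
  bounded_between alpha beta (cesaro_op mu) ->
  exists2 C : R, 0 < C & forall n : nat,
    moment mu n <= C / n.+1%:R `^ (1 + (alpha - beta) / 2).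
Proof.
move=> a2 b0 [_ [C C0 bnd]].
exists (2 * C * (1 + (2 - alpha)^-1)).
  by rewrite !mulr_gt0 // ltr_pwDl // invr_ge0 subr_ge0 ltW.
move=> N; apply: cesaro_test_bound => //; [exact: ltW|exact: moment_ge0|
  by move=> n k; exact: moment_nonincreasing|].
pose a (n : nat) : R[i]^o := if (n < N.+1)%N then 1 else 0.
have na n : normc (a n) = if (n < N.+1)%N then 1 else 0.
  by rewrite /a; case: ifP; rewrite ?ComplexField.Normc.normc1 ?ComplexField.Normc.normc0.
have na1 n : normc (a n) <= 1 by rewrite na; case: ifP.
pose f (z : R[i]^o) : R[i]^o := \sum_(n < N.+1) a n * z ^+ n.
have fa : has_power_series f a.
  by move=> z _; apply: power_series_finite_support => n Nn; rewrite /a ltnNge Nn.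
have ga : linear_growth a.
  by exists 1 => // n; rewrite mul1r; apply: le_trans (na1 n) _; rewrite ler1n.
(* The coefficients vanish from index N + 1 on, so a longer partial sum adds nothing and a shorter
   one only omits nonnegative terms. *)
have sum_a M : \sum_(n < M) n.+1%:R `^ (1 - alpha) * normc (a n) ^+ 2 <=
    \sum_(n < N.+1) n.+1%:R `^ (1 - alpha).
  have [MN|NM] := leqP M N.+1.
    rewrite (big_ord_widen N.+1 (fun n => n.+1%:R `^ (1 - alpha) * normc (a n) ^+ 2)) //.
    rewrite big_mkcond; apply: ler_sum => n _; case: ifP; rewrite ?powR_ge0 // => _.
    by rewrite na ltn_ord expr1n mulr1.
  rewrite [leRHS](big_ord_widen M (fun n => n.+1%:R `^ (1 - alpha))) ?(ltnW NM) //.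
  rewrite [leRHS]big_mkcond; apply: ler_sum => n _; rewrite na.
  by case: ifP; rewrite ?expr1n ?mulr1 // expr0n mulr0.
have Da : (dirichlet_sum alpha a <= (\sum_(n < N.+1) n.+1%:R `^ (1 - alpha))%:E)%E.
  by apply: dirichlet_sum_le => M; rewrite lee_fin.
have fD : dirichlet_space alpha f.
  by apply: dirichlet_space_power_series ga fa _; apply: le_lt_trans Da _; rewrite ltry.
(* The moments are at most mu[0], and a partial sum of n + 1 coefficients, each 0 or 1, is at most n
   + 1. *)
have gb : linear_growth (cesaro_coef (coef f)).
  exists (moment mu 0); first exact: moment_ge0.
  move=> n; apply: le_trans (normc_cesaro_coef_le _ _) _.
  apply: ler_pM; rewrite ?moment_ge0 ?moment_nonincreasing //.
    by apply: sumr_ge0 => k _; exact: normc_ge0.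
  rewrite (coefE fa); apply: (@le_trans _ _ (\sum_(k < n.+1) 1)).
    by apply: ler_sum => k _; exact: na1.
  by rewrite sumr_const card_ord.
have := bnd f fD; rewrite !dirichlet_normE (coefE (cesaro_op_power_series gb)) (coefE fa).
move=> /poweR12_le_scaled -/(_ (ltW C0) (dirichlet_sum_ge0 _ _) (dirichlet_sum_ge0 _ _)) h.
rewrite -lee_fin.
(* For n <= N all of a_0, ..., a_n are 1, so the n-th coefficient of the image is exactly mu[n] (n +
   1); the later ones are dropped. *)
apply: (@le_trans _ _ (dirichlet_sum beta (cesaro_coef a))).
  apply: le_trans (dirichlet_partial_sum_le _ _ N.+1); rewrite lee_fin.
  apply: ler_sum => n _; rewrite ler_wpM2l ?powR_ge0 //.
  rewrite /cesaro_coef (eq_bigr (fun=> 1)); last first.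
    by move=> k _; rewrite /a (leq_trans (ltn_ord k)).
  rewrite sumr_const card_ord ComplexField.Normc.normcM normcR normc_nat.
  by rewrite ger0_norm ?moment_ge0.
by apply: le_trans h _; rewrite (EFinM (C ^+ 2)) lee_wpmul2l ?lee_fin ?sqr_ge0.
Qed.

End cesaro.

(* A finite Borel measure on [0, 1) is represented by a finite Borel measure on
   the real line that vanishes outside [0, 1). *)
Theorem theorem1p2 (R : realType) (alpha beta : R)
    (halpha : 0 < alpha < 2) (hbeta : 0 < beta < 2)
    (mu : {finite_measure set (measurableTypeR R) -> \bar R})
    (hmu : mu (~` [set` `[0%R, 1%R[]) = 0%E) :
  (bounded_between alpha beta (cesaro_op mu) <->
   carleson_measure (1 + (alpha - beta) / 2) mu) /\
  (carleson_measure (1 + (alpha - beta) / 2) mu <->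
   exists2 C : R, 0 < C & forall n : nat,
     moment mu n <= C / (n.+1%:R `^ (1 + (alpha - beta) / 2))).
Proof.
have /andP[a0 a2] := halpha; have /andP[b0 b2] := hbeta.
have s0 : 0 <= 1 + (alpha - beta) / 2 by lra.
have s2 : 0 <= 1 + (alpha - beta) / 2 <= 2 by lra.
have carlesonP : carleson_measure (1 + (alpha - beta) / 2) mu <->
   exists2 C : R, 0 < C & forall n : nat,
     moment mu n <= C / (n.+1%:R `^ (1 + (alpha - beta) / 2)).
  by split; [exact: moment_of_carleson|exact: carleson_of_moment].
split; last exact: carlesonP.
split=> [h|/carlesonP h].
  by apply/carlesonP; exact: moment_of_bounded h.
exact: bounded_of_moment h.
Qed.
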